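(* Consider the discrete-time delayed averaging algorithm $$x_i(t+1)=x_i(t)+\sum_{j\in\mathcal V,\ j\ne i}a_{ij}(t)\bigl(x_j(t-h_{ij}(t))-x_i(t)\bigr),\qquad i\in\mathcal V,$$ where $A(t)=(a_{ij}(t))$, $t=0,1,\dots$, are stochastic matrices, $\bar h\ge0$ is an integer and $h_{ij}(t)\in\{0,1,\dots,\bar h\}$ are arbitrary. Assume that the sequence $\{A(t)\}$ possesses the non-instantaneous type-symmetry (NITS) property and is strongly aperiodic. Then every solution converges (the limits $\bar x_i=\lim_{t\to\infty}x_i(t)$ exist for all $i\in\mathcal V$), and the algorithm establishes consensus between agents $i$ and $j$ if they belong to the same connected component of the persistent graph $\mathcal G_\infty$.
   Context: $\mathcal V$ is a finite nonempty set of agents. A stochastic matrix is a nonnegative matrix whose rows each sum to $1$. The sequence $A(t)$ is strongly aperiodic if there is $\eta>0$ with $a_{ii}(t)\ge\eta$ for all $i\in\mathcal V$ and all $t$. Solutions: for an integer starting time $t_*\ge0$, the solution is determined for $t>t_*$ by arbitrary initial values $x(t_* ),\dots,x(t_*-\bar h)\in\mathbb R^{\mathcal V}$. Consensus between $i$ and $j$ is established if for every $t_*$ and all initial values the limits $\bar x_i,\bar x_j$ exist and $\bar x_i=\bar x_j$. NITS (discrete time): there exist an increasing sequence of integers $0\le t_0<t_1<\dots$ and a constant $K\ge1$ such that (1) for all $i,j\in\mathcal V$ and all $p\ge 0$, $\frac1K\sum_{t=t_p}^{t_{p+1}-1}a_{ji}(t)\le\sum_{t=t_p}^{t_{p+1}-1}a_{ij}(t)\le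 K\sum_{t=t_p}^{t_{p+1}-1}a_{ji}(t)$; (2) $\sup_{p\ge0,\ i\ne j}\sum_{t=t_p}^{t_{p+1}-1}a_{ij}(t)<\infty$. The persistent graph $\mathcal G_\infty=(\mathcal V,\mathcal E_\infty)$ has the arc $(j,i)$, $j\ne i$, if and only if $\sum_{t=0}^\infty a_{ij}(t)=\infty$. Under NITS it is undirected. *)

(* Defs.v *)
(* MathComp + MathComp-Analysis. *)
From mathcomp Require Import all_boot all_order all_algebra.
From mathcomp Require Import all_classical all_reals all_analysis.
Import Order.TTheory GRing.Theory Num.Theory.
Import numFieldNormedType.Exports.

Set Implicit Arguments.
Unset Strict Implicit.
Unset Printing Implicit Defensive.

Local Open Scope classical_set_scope.
Local Open Scope ring_scope.

(* A matrix indexed by the agents is a function V -> V -> R, and a i j is the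
   weight that agent i gives to agent j. *)

Definition stochastic (R : realType) (V : finType) (a : V -> V -> R) : Prop :=
  (forall i j, 0 <= a i j) /\ (forall i, \sum_j a i j = 1).

Definition strongly_aperiodic (R : realType) (V : finType)
    (A : nat -> V -> V -> R) : Prop :=
  exists2 eta : R, 0 < eta & forall t i, eta <= A t i i.

(* The last clause is the finiteness of the supremum over p and i != j. *)
Definition NITS (R : realType) (V : finType) (A : nat -> V -> V -> R) : Prop :=
  exists (T : nat -> nat) (K : R),
    [/\ forall p, (T p < T p.+1)%N,
        1 <= K,
        forall i j p,
          K^-1 * \sum_(T p <= t < T p.+1) A t j i
            <= \sum_(T p <= t < T p.+1) A t i j
            <= K * \sum_(T p <= t < T p.+1) A t j i
      & exists M : R, forall p i j, i != j ->
          \sum_(T p <= t < T p.+1) A t i j <= M].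

(* persistent_graph A j i : the arc (j, i) is present. *)
Definition persistent_graph (R : realType) (V : finType)
    (A : nat -> V -> V -> R) : rel V :=
  fun j i => (j != i) && `[< (\sum_(0 <= t <oo) (A t i j)%:E = +oo)%E >].

(* Membership in one component of the undirected graph e is the existence of
   a walk; the persistent graph is symmetric whenever NITS holds. *)
Definition same_component (V : finType) (e : rel V) (i j : V) : Prop :=
  connect e i j.

(* Time ranges over int because the initial data x(t0), ..., x(t0 - hbar)
   may involve negative times.  The initial data are the unconstrained values
   of x up to time t0; when all delays are at most hbar, the values before
   t0 - hbar are never used. *)
Definition solution (R : realType) (V : finType) (A : nat -> V -> V -> R)
    (h : nat -> V -> V -> nat) (t0 : nat) (x : int -> V -> R) : Prop :=
  forall (t : nat) (i : V), (t0 <= t)%N ->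
    x t.+1%:Z i =
      x t%:Z i + \sum_(j | j != i)
                   A t i j * (x (t%:Z - (h t i j)%:Z) j - x t%:Z i).

Definition trajectory (R : realType) (V : finType) (x : int -> V -> R) (i : V) :
    R^nat :=
  fun t => x t%:Z i.

Definition establishes_consensus (R : realType) (V : finType)
    (A : nat -> V -> V -> R) (h : nat -> V -> V -> nat) (i j : V) : Prop :=
  forall (t0 : nat) (x : int -> V -> R), solution A h t0 x ->
    [/\ cvgn (trajectory x i), cvgn (trajectory x j)
      & limn (trajectory x i) = limn (trajectory x j)].

(* Main.v *)
Require Import Defs.
From mathcomp Require Import all_boot all_order all_algebra.
From mathcomp Require Import all_classical all_reals all_analysis.
From mathcomp Require Import ring lra zify.
Import Order.TTheory GRing.Theory Num.Theory.
Import numFieldNormedType.Exports.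

(** The update writes x_i(t+1) as the mean, under the weights a_ij(t), of the
    delayed values x_j(t - h_ij(t)), the own value being taken without delay.
    Replacing values by a mean loses their variance: the quantity
      D(t) = sum over i, j of a_ij(t) (x_j(t - h_ij(t)) - x_i(t+1))^2
    is the amount by which the squares decrease.  Everything follows from the
    finiteness of the sum of all D(t) ([dissipation_summable]).

    That sum is bounded by duality.  Fix a horizon N and run the averaging
    backwards as a transport of mass: one unit starts at every agent at the
    time N, and the mass found at agent i at time t+1 is sent to the agents j
    in the proportions a_ij(t), landing there at time t - h_ij(t).  The pairing
    of the mass with the squares x_j^2 grows, in one backward step, by the
    variance of every agent times its landed mass.  The squares are bounded and
    the total mass is constant, so the variances weighted by the landed mass
    have a bounded sum ([defect_total]).  It remains to see that the landed mass
    of every agent is at least a positive constant that does not depend on N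
    ([landed_lower]); this is where reciprocity enters.  The induction runs on
    the size of a set L of agents, downwards from the set of all agents, whose
    mass is constant ([mass_on_lower]).  Over a stretch of time in which the
    weights leading out of L have a bounded sum, L keeps a fixed fraction of its
    mass ([mass_on_growth]).  If that sum is also large, then by reciprocity the
    weights leading into L have a sum of at least one; and if L has little mass,
    then every outside agent has a substantial mass, because adding it to L
    gives a larger set.  Hence L receives a fixed amount during the stretch.

    With the total dissipation finite, the trajectories converge as follows.
    Late in time single steps are small.  If then no value lies between two
    levels c and c + b, the agents below and those above stay apart for ever: as
    long as they are apart, weights across the gap cost a proportional
    dissipation, and too little is left to close it ([stay_separated]).  Among
    #|V| + 1 consecutive levels above the value of an agent one is always empty,
    so the agent never climbs by more than (#|V| + 1) b, and by symmetry never
    sinks by more ([stay_below]).  So the trajectory is a Cauchy sequence.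
    Finally, an arc between agents with different limits dissipates in
    proportion to its weights, so its total weight is finite and the arc is not
    persistent ([separated_limits_finite_weight]). *)

Set Implicit Arguments.
Unset Strict Implicit.
Unset Printing Implicit Defensive.

Local Open Scope classical_set_scope.
Local Open Scope ring_scope.

(** * Mass transported backwards in time *)

Section Mass.
Variables (R : realType) (V : finType) (B : nat -> V -> V -> R).
Variables (H : nat -> V -> V -> nat) (hbar N : nat) (eta K E : R).
Hypothesis B_stochastic : forall s, stochastic (B s).
Hypothesis eta_gt0 : 0 < eta.
Hypothesis B_diag : forall s i, eta <= B s i i.
Hypothesis H_le : forall s i j, (H s i j <= hbar)%N.
Hypothesis H_diag : forall s i, H s i i = 0%N.
Hypothesis K_ge1 : 1 <= K.
Hypothesis E_ge0 : 0 <= E.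
Hypothesis B_reciprocal : forall i j s1 s2, i != j -> (s1 <= s2 <= N)%N ->
  \sum_(s1 <= s < s2) B s i j <= K * \sum_(s1 <= s < s2) B s j i + E.

(** Step s counts time backwards from the horizon.  [mass s j d] is the mass
    that will land at agent j after d more backward steps; the mass with d = 0
    has landed and is redistributed by the next step. *)
Fixpoint mass (s : nat) : V -> nat -> R :=
  if s is s'.+1 then
    fun j d => mass s' j d.+1
      + \sum_i mass s' i 0%N * B s' i j * (H s' i j == d)%:R
  else fun _ d => (d == 0%N)%:R.

Definition landed s i := mass s i 0%N.
Definition mass_at s j := \sum_(d < hbar.+1) mass s j d.
Definition mass_on s (L : {set V}) := \sum_(j in L) mass_at s j.

Lemma B_ge0 s i j : 0 <= B s i j.
Proof. by case: (B_stochastic s). Qed.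

Lemma B_sum1 s i : \sum_j B s i j = 1.
Proof. by case: (B_stochastic s). Qed.

Lemma B_sum_le1 s i (P : pred V) : \sum_(j | P j) B s i j <= 1.
Proof.
rewrite -(B_sum1 s i) [leRHS](bigID P)/= lerDl.
by apply: sumr_ge0 => j _; exact: B_ge0.
Qed.

Lemma mass_ge0 s j d : 0 <= mass s j d.
Proof.
elim: s j d => [|s IH] j d /=; first by rewrite ler0n.
apply: addr_ge0 => //; apply: sumr_ge0 => i _.
by rewrite !mulr_ge0 ?B_ge0.
Qed.

Lemma landed_ge0 s i : 0 <= landed s i.
Proof. exact: mass_ge0. Qed.

Lemma mass_at_ge0 s i : 0 <= mass_at s i.
Proof. by apply: sumr_ge0 => d _; exact: mass_ge0. Qed.

Lemma mass_beyond s j d : (hbar < d)%N -> mass s j d = 0.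
Proof.
elim: s j d => [|s IH] j d lt_hd /=; first by case: d lt_hd.
rewrite IH ?(ltn_trans lt_hd)// add0r big1// => i _.
case: eqP => [Hd|_]; last by rewrite mulr0.
by move: (H_le s i j); rewrite Hd leqNgt lt_hd.
Qed.

(** The transpose of the averaging step: pairing the new mass with a test
    function amounts to pairing the landed mass with averages of that
    function. *)
Lemma mass_step s (f : V -> nat -> R) :
  \sum_j \sum_(d < hbar.+1) mass s.+1 j d * f j d =
  \sum_j \sum_(d < hbar) mass s j d.+1 * f j d
  + \sum_i landed s i * \sum_j B s i j * f j (H s i j).
Proof.
under eq_bigr do under eq_bigr do rewrite /= mulrDl.
under eq_bigr do rewrite big_split /=.
rewrite big_split /=; congr (_ + _).
  apply: eq_bigr => j _; rewrite big_ord_recr /=.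
  by rewrite mass_beyond// mul0r addr0.
under [RHS]eq_bigr do rewrite mulr_sumr.
rewrite [RHS]exchange_big /=; apply: eq_bigr => j _.
under eq_bigr do rewrite mulr_suml.
rewrite exchange_big /=; apply: eq_bigr => i _.
have Hlt : (H s i j < hbar.+1)%N by rewrite ltnS.
rewrite (bigD1 (Ordinal Hlt))//= eqxx mulr1 big1 ?addr0 ?mulrA// => d ne_d.
rewrite [_ == _](_ : _ = false) ?mulr0 ?mul0r//.
by apply/negbTE; apply: contra ne_d => /eqP Hd; apply/eqP/val_inj.
Qed.

Lemma mass_on_step s (L : {set V}) :
  mass_on s.+1 L = mass_on s L
   - \sum_(i in L) landed s i * \sum_(j in ~: L) B s i j
   + \sum_(i in ~: L) landed s i * \sum_(j in L) B s i j.
Proof.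
have key t : mass_on t L =
    \sum_j \sum_(d < hbar.+1) mass t j d * (j \in L)%:R.
  rewrite /mass_on big_mkcond; apply: eq_bigr => j _.
  by rewrite -mulr_suml; case: (j \in L); rewrite ?mulr1 ?mulr0.
rewrite [LHS]key (mass_step s (fun j _ => (j \in L)%:R)) key.
have BL i : \sum_j B s i j * (j \in L)%:R = \sum_(j in L) B s i j.
  rewrite [RHS]big_mkcond; apply: eq_bigr => j _.
  by case: (j \in L); rewrite ?mulr1 ?mulr0.
under [X in _ + X = _]eq_bigr do rewrite BL.
under [in RHS]eq_bigr do rewrite big_ord_recl.
rewrite [X in _ = X - _ + _]big_split /=.
rewrite [X in _ + X = _](bigID (mem L))/= addrA.
under [X in _ = _ + X]eq_bigl do rewrite finset.in_setC.
congr (_ + _); rewrite addrC; rewrite addrAC; congr (_ + _).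
under [X in X - _]eq_bigr => i _.
  rewrite [_ * _](_ : _ = if i \in L then landed s i else 0); last first.
    by case: (i \in L); rewrite ?mulr1 ?mulr0.
  over.
rewrite -big_mkcond /= -sumrB; apply: eq_bigr => i iL.
rewrite -{2}[landed s i]mulr1 -mulrBr; congr (_ * _).
rewrite -(B_sum1 s i) [X in _ = X - _](bigID (mem L))/=.
under [X in _ - X]eq_bigl do rewrite finset.in_setC.
by rewrite addrK.
Qed.

Lemma mass_total s : mass_on s [set: V]%SET = #|V|%:R.
Proof.
elim: s => [|s IH]; last first.
  rewrite mass_on_step IH finset.setCT !big_set0 addr0 big1 ?subr0// => i _.
  by rewrite big_set0 mulr0.
rewrite /mass_on (eq_bigr (fun=> 1)) => [|j _]; last first.
  by rewrite /mass_at big_ord_recl /= big1 ?addr0.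
by rewrite sumr_const cardsT.
Qed.

Lemma mass_on0 L : mass_on 0 L = #|L|%:R.
Proof.
rewrite /mass_on (eq_bigr (fun=> 1)) => [|j _]; last first.
  by rewrite /mass_at big_ord_recl /= big1 ?addr0.
by rewrite sumr_const.
Qed.

Lemma mass_on_ge0 s L : 0 <= mass_on s L.
Proof. by apply: sumr_ge0 => i _; exact: mass_at_ge0. Qed.

Lemma landed_le_mass_at s i : landed s i <= mass_at s i.
Proof.
rewrite /mass_at big_ord_recl lerDl.
by apply: sumr_ge0 => d _; exact: mass_ge0.
Qed.

Lemma landed_keep s i : eta * landed s i + mass s i 1 <= landed s.+1 i.
Proof.
rewrite /landed /= addrC lerD2l (bigD1 i)//= H_diag eqxx mulr1 mulrC.
rewrite ler_wpDr// ?ler_wpM2l ?mass_ge0 ?B_diag//.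
by apply: sumr_ge0 => j _; rewrite !mulr_ge0 ?B_ge0 ?mass_ge0.
Qed.

Lemma eta_le1 (i : V) : eta <= 1.
Proof.
apply: le_trans (B_diag 0 i) _; rewrite -(B_sum1 0 i) (bigD1 i)//= lerDl.
by apply: sumr_ge0 => j _; exact: B_ge0.
Qed.

(** All the mass in flight towards i lands within [hbar] steps, and landed mass
    loses at most the factor [eta] per step. *)
Lemma landed_after s i k :
  eta ^+ k * \sum_(d < k.+1) mass s i d <= landed (s + k) i.
Proof.
elim: k s => [|k IH] s.
  by rewrite expr0 mul1r big_ord_recl big_ord0 addr0 addn0.
rewrite addnS -addSn; apply: le_trans (IH s.+1).
rewrite exprSr -mulrA ler_wpM2l ?exprn_ge0 ?(ltW eta_gt0)//.
rewrite [in leLHS]big_ord_recl [leRHS]big_ord_recl mulrDr.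
have /= := landed_keep s i; rewrite /landed => keep.
apply: (@le_trans _ _ (eta * mass s i 0 + \sum_(d < k.+1) mass s i d.+1)).
  rewrite lerD2l ler_piMl ?eta_le1//.
  by apply: sumr_ge0 => d _; exact: mass_ge0.
rewrite big_ord_recl addrA; apply: lerD => //.
apply: ler_sum => d _ /=; rewrite lerDl.
by apply: sumr_ge0 => j _; rewrite !mulr_ge0 ?B_ge0 ?mass_ge0.
Qed.

Definition outflow (L : {set V}) s := \sum_(i in L) \sum_(j in ~: L) B s i j.
Definition inflow (L : {set V}) s := \sum_(i in ~: L) \sum_(j in L) B s i j.

Lemma outflow_ge0 L s : 0 <= outflow L s.
Proof. by apply: sumr_ge0 => i _; apply: sumr_ge0 => j _; exact: B_ge0. Qed.

Lemma inflow_ge0 L s : 0 <= inflow L s.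
Proof. by apply: sumr_ge0 => i _; apply: sumr_ge0 => j _; exact: B_ge0. Qed.

Lemma cross_le_card (P Q : pred V) s :
  \sum_(i | P i) \sum_(j | Q j) B s i j <= #|V|%:R.
Proof.
apply: (@le_trans _ _ (\sum_(i | P i) 1)).
  by apply: ler_sum => i _; exact: B_sum_le1.
by rewrite sumr_const ler_nat max_card.
Qed.

(** The exponential makes the bound multiplicative over time.  It holds for
    large outflow too, because an agent keeps at least the share [eta]; this is
    why the exponent carries the factor 1 / eta. *)
Lemma stay_share (L : {set V}) s i : i \in L ->
  expR (- (outflow L s / eta)) <= 1 - \sum_(j in ~: L) B s i j.
Proof.
move=> iL; set b := \sum_(j in _) _.
have b_ge0 : 0 <= b by apply: sumr_ge0 => j _; exact: B_ge0.
have b_out : b <= outflow L s.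
  rewrite /outflow (bigD1 i)//= lerDl.
  by apply: sumr_ge0 => k _; apply: sumr_ge0 => j _; exact: B_ge0.
have b_eta : eta <= 1 - b.
  have split1 : b + \sum_(j in L) B s i j = 1.
    rewrite -(B_sum1 s i) [RHS](bigID (mem (~: L)))/=; congr (_ + _).
    by apply: eq_bigl => j; rewrite inE negbK.
  rewrite -split1 addrAC subrr add0r (bigD1 i)//= ler_wpDr ?B_diag//.
  by apply: sumr_ge0 => j _; exact: B_ge0.
rewrite expRN invf_ple ?posrE ?expR_gt0 ?(lt_le_trans eta_gt0)//.
apply: le_trans (expR_ge1Dx _).
apply: (@le_trans _ _ (1 + b / eta)); last first.
  by rewrite lerD2l ler_pM2r ?invr_gt0.
have pos : 0 < 1 - b := lt_le_trans eta_gt0 b_eta.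
rewrite -[leLHS]mul1r ler_pdivrMr//.
have -> : (1 + b / eta) * (1 - b) = 1 + b * (1 - eta - b) / eta.
  by field; rewrite gt_eqF.
by rewrite lerDl divr_ge0 ?mulr_ge0 ?(ltW eta_gt0)//; lra.
Qed.

(** Variation of constants for the mass of L: what L owns, and what it receives
    from outside agents with landed mass at least g, is reduced by no more than
    the factor that the total outflow allows. *)
Lemma mass_on_growth (L : {set V}) g s1 s2 : 0 <= g -> (s1 <= s2)%N ->
  (forall r i, (s1 <= r < s2)%N -> i \notin L -> g <= landed r i) ->
  expR (- (\sum_(s1 <= r < s2) outflow L r / eta))
    * (mass_on s1 L + g * \sum_(s1 <= r < s2) inflow L r) <= mass_on s2 L.
Proof.
move=> g_ge0; elim: s2 => [|s IH] le_s.
  move: le_s; rewrite leqn0 => /eqP -> _.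
  by rewrite !big_geq// oppr0 expR0 mul1r mulr0 addr0.
move: le_s; rewrite leq_eqVlt ltnS => /orP[/eqP -> _|le_s land].
  by rewrite !big_geq// oppr0 expR0 mul1r mulr0 addr0.
have {}IH := IH le_s (fun r i hr => land r i ltac:(lia)).
rewrite !big_nat_recr//= opprD expRD.
set e := expR (- \sum_(_ <= _ < _) _); set e1 := expR _.
set m1 := mass_on s1 L; set Iw := \sum_(_ <= _ < _) _.
rewrite -/e -/m1 -/Iw in IH.
have e_ge0 : 0 <= e := expR_ge0 _.
have e1_ge0 : 0 <= e1 := expR_ge0 _.
have le1 (z : R) : 0 <= z -> expR (- z) <= 1.
  by move=> z0; rewrite -expR0 ler_expR oppr_le0.
have e_le1 : e <= 1.
  apply/le1/sumr_ge0 => r _.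
  by rewrite divr_ge0 ?outflow_ge0// ltW.
have e1_le1 : e1 <= 1 by apply/le1; rewrite divr_ge0 ?outflow_ge0// ltW.
have step : e1 * mass_on s L + g * inflow L s <= mass_on s.+1 L.
  rewrite mass_on_step; apply: lerD; last first.
    rewrite /inflow mulr_sumr; apply: ler_sum => i; rewrite inE => iL.
    rewrite ler_wpM2r ?sumr_ge0// => [j _|]; first exact: B_ge0.
    by apply: land => //; rewrite le_s ltnSn.
  rewrite /mass_on mulr_sumr -sumrB; apply: ler_sum => i iL.
  have := stay_share s iL; rewrite -/e1.
  set b := \sum_(j in _) _ => e1b.
  have b_ge0 : 0 <= b by apply: sumr_ge0 => j _; exact: B_ge0.
  have := landed_le_mass_at s i; have := landed_ge0 s i.
  nra.
apply: le_trans step; rewrite mulrDr.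
have I_ge0 : 0 <= inflow L s := inflow_ge0 L s.
have gI : 0 <= g * inflow L s by rewrite mulr_ge0.
have ee_le1 : e * e1 <= 1 by rewrite mulr_ile1.
have -> : e * e1 * m1 + e * e1 * (g * (Iw + inflow L s)) =
  e1 * (e * (m1 + g * Iw)) + e * e1 * (g * inflow L s) by ring.
apply: lerD; first by rewrite ler_wpM2l.
by rewrite ler_piMl.
Qed.

Lemma cross_reciprocal (L : {set V}) s1 s2 : (s1 <= s2 <= N)%N ->
  \sum_(s1 <= s < s2) outflow L s
    <= K * \sum_(s1 <= s < s2) inflow L s + #|V|%:R ^+ 2 * E.
Proof.
move=> hs; rewrite /inflow /outflow.
rewrite exchange_big [X in K * X]exchange_big/=.
under eq_bigr do rewrite exchange_big/=.
under [X in K * X]eq_bigr do rewrite exchange_big/=.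
rewrite [X in K * X]exchange_big/= mulr_sumr.
apply: (@le_trans _ _ (\sum_(i in L)
   (K * \sum_(j in ~: L) \sum_(s1 <= s < s2) B s j i + #|V|%:R * E))).
  apply: ler_sum => i iL; rewrite mulr_sumr.
  apply: (@le_trans _ _ (\sum_(j in ~: L)
     (K * \sum_(s1 <= s < s2) B s j i + E))).
    apply: ler_sum => j; rewrite inE => jL; apply: B_reciprocal => //.
    by apply: contra jL => /eqP <-.
  rewrite big_split/= lerD2l sumr_const -[leLHS]mulr_natl ler_wpM2r//.
  by rewrite ler_nat max_card.
rewrite big_split/= lerD2l sumr_const -[leLHS]mulr_natl expr2 -mulrA.
by rewrite ler_wpM2r ?mulr_ge0// ler_nat max_card.
Qed.

(** Going back from s, bounded increments allow to stop when the sum has just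
    passed X, unless time 0 is reached before. *)
Lemma last_stretch (u : nat -> R) (c X : R) s : 0 <= X ->
  (forall r, u r <= c) -> 0 <= c ->
  exists2 s2, (s2 <= s)%N & \sum_(s2 <= r < s) u r <= X + c /\
    (s2 = 0%N \/ X < \sum_(s2 <= r < s) u r).
Proof.
move=> X_ge0 uc c_ge0; pose P k := \sum_(k <= r < s) u r <= X + c.
have exP : exists k, P k by exists s; rewrite /P big_geq// addr_ge0.
case: (ex_minnP exP) => k Pk kmin.
have ks : (k <= s)%N by apply: kmin; rewrite /P big_geq// addr_ge0.
exists k => //; split => //.
case: k Pk kmin ks => [|k] Pk kmin ks; first by left.
right; have : ~~ P k by apply: contraT => /negPn /kmin; rewrite ltnn.
rewrite /P -ltNge big_ltn// => lt; have := uc k; lra.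
Qed.

(** A total outflow of this size forces, by reciprocity, a total inflow above
    1 + hbar * #|V|.  The second term pays for the first [hbar] steps, during
    which outside mass may still be in flight; an inflow above 1 remains. *)
Definition stretch : R :=
  #|V|%:R ^+ 2 * E + K * (1 + hbar%:R * #|V|%:R).

(** The exponential is the part of a mass that survives a stretch, whose
    outflow exceeds [stretch] by at most that of one step, which is at most
    #|V|.  The other factor is the landed share of an outside agent that owns
    half of the bound known for the larger sets. *)
Definition decay : R :=
  expR (- ((stretch + #|V|%:R) / eta)) * (eta ^+ hbar / 2).

Lemma stretch_ge0 : 0 <= stretch.
Proof.
have K_ge0 : 0 <= K by apply: le_trans K_ge1.
by rewrite addr_ge0 ?mulr_ge0 ?exprn_ge0 ?addr_ge0 ?mulr_ge0.
Qed.

Lemma decay_gt0 : 0 < decay.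
Proof. by rewrite mulr_gt0 ?expR_gt0 ?divr_gt0 ?exprn_gt0. Qed.

Lemma eta_half_le1 (i : V) : eta ^+ hbar / 2 <= 1.
Proof.
have := exprn_ile1 hbar (ltW eta_gt0) (eta_le1 i); lra.
Qed.

(** Look at the last stretch of time before s.  If it reaches back to step 0,
    or if L is rich at some moment of it, then L has kept a fixed fraction since
    then.  Otherwise every outside agent is rich during the whole stretch, since
    together with L it forms a larger set, and L is supplied by the outside. *)
Lemma mass_on_lower m (L : {set V}) s :
  (0 < #|L|)%N -> (#|L| + m = #|V|)%N -> (s <= N)%N ->
  decay ^+ m <= mass_on s L.
Proof.
elim: m L s => [|m IH] L s L_gt0 cardL sN.
  have -> : L = [set: V]%SET.
    by apply/eqP; rewrite eqEcard finset.subsetT cardsT -cardL addn0 leqnn.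
  by rewrite mass_total expr0 ler1n -cardL addn0.
have [i0 i0L] : exists i, i \in L by apply/set0Pn; rewrite -card_gt0.
set beta := decay ^+ m.
have beta_gt0 : 0 < beta by rewrite exprn_gt0 ?decay_gt0.
have eh := eta_half_le1 i0.
have eh_gt0 : 0 < eta ^+ hbar / 2 by rewrite divr_gt0 ?exprn_gt0.
pose e := expR (- ((stretch + #|V|%:R) / eta)).
have e_gt0 : 0 < e := expR_gt0 _.
have e_le1 : e <= 1.
  rewrite -expR0 ler_expR oppr_le0 divr_ge0 ?(ltW eta_gt0)//.
  by rewrite addr_ge0 ?stretch_ge0.
have decay_le1 : decay <= 1.
  by rewrite /decay -/e mulr_ile1 ?(ltW e_gt0) ?(ltW eh_gt0).
have beta_le1 : beta <= 1 by rewrite exprn_ile1 ?(ltW decay_gt0).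
have out_le r : outflow L r <= #|V|%:R by exact: cross_le_card.
have [s2 s2s [short long]] :=
  last_stretch s stretch_ge0 out_le (ler0n _ _).
have below s' : (s2 <= s' <= s)%N ->
    e <= expR (- (\sum_(s' <= r < s) outflow L r / eta)).
  move=> /andP[s2s' s's].
  rewrite ler_expR lerN2 -mulr_suml ler_pM2r ?invr_gt0//.
  apply: le_trans short; rewrite (big_cat_nat s2s' s's)/= lerDr.
  by apply: sumr_ge0 => r _; exact: outflow_ge0.
have from s' : (s2 <= s' <= s)%N -> e * mass_on s' L <= mass_on s L.
  move=> hs'; have s's : (s' <= s)%N by case/andP: hs'.
  apply: le_trans (mass_on_growth (lexx 0) s's _).
    by rewrite mul0r addr0 ler_wpM2r ?mass_on_ge0// below.
  by move=> r i _ _; exact: landed_ge0.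
rewrite exprS -/beta /decay -/e.
have goal_le (x : R) : eta ^+ hbar / 2 * beta <= x ->
   e * x <= mass_on s L -> e * (eta ^+ hbar / 2) * beta <= mass_on s L.
  move=> hx; apply: le_trans.
  by rewrite -mulrA ler_wpM2l// ltW.
(* The stretch reaches back to step 0, where L owns one unit per agent. *)
case: long => [s20|long].
  apply: (goal_le 1); first by rewrite mulr_ile1 ?(ltW eh_gt0) ?(ltW beta_gt0).
  apply: le_trans (from 0%N _); last by rewrite s20.
  by rewrite mass_on0 ler_wpM2l ?ler1n// ltW.
have [[r [hr big_r]]|small] := pselect
    (exists r, (s2 <= r <= s)%N /\ beta / 2 <= mass_on r L).
  apply: (goal_le (mass_on r L)); last exact: from.
  apply: le_trans big_r; have := exprn_ile1 hbar (ltW eta_gt0) (eta_le1 i0).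
  nra.
(* From here on L is poor during the whole stretch. *)
have outside r i : (s2 <= r <= s)%N -> i \notin L -> beta / 2 <= mass_at r i.
  move=> hr iL; have rs : (r <= s)%N by case/andP: hr.
  have : ~ (beta / 2 <= mass_on r L) by move=> h; apply: small; exists r.
  move/negP; rewrite -ltNge => ltL.
  have cardU : #|i |: L| = #|L|.+1 by rewrite cardsU1 iL.
  have : beta <= mass_on r (i |: L).
    apply: IH => //; first by rewrite cardU.
      by rewrite cardU addSnnS.
    exact: leq_trans rs sN.
  rewrite {1}/mass_on big_setU1//= -/(mass_on r L); lra.
have landing r i : (s2 + hbar <= r < s)%N -> i \notin L ->
    eta ^+ hbar * (beta / 2) <= landed r i.
  move=> /andP[hr rs] iL.
  have [rE hr'] : (r = (r - hbar) + hbar)%N /\ (s2 <= r - hbar <= s)%N.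
    by clear -hr rs; lia.
  rewrite rE; apply: le_trans (landed_after _ _ _).
  rewrite ler_wpM2l ?exprn_ge0 ?(ltW eta_gt0)//; exact: outside.
have recip := @cross_reciprocal L s2 s ltac:(by rewrite s2s).
have in_long : 1 + hbar%:R * #|V|%:R < \sum_(s2 <= r < s) inflow L r.
  rewrite -(@ltr_pM2l _ K) ?(lt_le_trans _ K_ge1)//.
  rewrite /stretch in long; lra.
have in_le a b : \sum_(a <= r < b) inflow L r <= (b - a)%:R * #|V|%:R.
  apply: (@le_trans _ _ (\sum_(a <= r < b) #|V|%:R)).
    by apply: ler_sum => r _; exact: cross_le_card.
  by rewrite sumr_const_nat mulr_natl.
have hs : (s2 + hbar <= s)%N.
  rewrite leqNgt; apply/negP => short_s; have := in_le s2 s => h1.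
  have : (s - s2)%:R * #|V|%:R <= hbar%:R * #|V|%:R :> R.
    by rewrite ler_wpM2r// ler_nat; clear -short_s; lia.
  lra.
have in_late : 1 <= \sum_(s2 + hbar <= r < s) inflow L r.
  move: in_long; rewrite (big_cat_nat (leq_addr hbar s2) hs)/=.
  have := in_le s2 (s2 + hbar)%N; rewrite addKn; lra.
apply: (goal_le (eta ^+ hbar * (beta / 2))); first by lra.
have hs2 : (s2 <= s2 + hbar <= s)%N by rewrite leq_addr.
have g_ge0 : 0 <= eta ^+ hbar * (beta / 2).
  by rewrite mulr_ge0 ?exprn_ge0 ?divr_ge0// ltW.
apply: le_trans (mass_on_growth g_ge0 hs landing).
apply: ler_pM (below _ hs2) _ => //; first exact: ltW.
by rewrite ler_wpDl ?mass_on_ge0// ler_peMr.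
Qed.

Definition mass_floor := eta ^+ hbar * decay ^+ #|V|.-1.

Lemma mass_floor_gt0 : 0 < mass_floor.
Proof. by rewrite mulr_gt0 ?exprn_gt0 ?decay_gt0. Qed.

Lemma landed_lower s i : (s <= N)%N -> mass_floor <= landed s i.
Proof.
move=> sN; have eta01 := eta_le1 i.
have eta_ge0 := ltW eta_gt0.
have lower s' : (s' <= N)%N -> decay ^+ #|V|.-1 <= mass_at s' i.
  move=> s'N; have := @mass_on_lower #|V|.-1 [set i]%SET s'.
  rewrite cards1 /mass_on big_set1 add1n prednK//.
    by apply.
  by apply/card_gt0P; exists i.
have [hs|sh] := leqP hbar s.
  rewrite -(subnK hs); apply: le_trans (landed_after _ _ _).
  rewrite ler_wpM2l ?exprn_ge0//; apply: lower.
  by apply: leq_trans sN; exact: leq_subr.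
(* In the first hbar steps, follow the unit that starts at i. *)
have at0 : mass_at 0 i = 1 by rewrite /mass_at big_ord_recl /= big1 ?addr0.
rewrite -[s]add0n; apply: le_trans (landed_after _ _ _).
rewrite big_ord_recl big1 ?addr0//= mulr1.
apply: (@le_trans _ _ (eta ^+ hbar)).
  by rewrite ler_piMr ?exprn_ge0// -at0 lower.
by rewrite ler_wiXn2l// ltnW.
Qed.

(** For z = x^2 along a solution, the excess of the average of the squares over
    the square of the average. *)
Definition defect (z : nat -> V -> R) s i :=
  \sum_j B s i j * z (N - s.+1 + hbar - H s i j)%N j - z (N - s + hbar)%N i.

Lemma pairing_step (z : nat -> V -> R) s : (s < N)%N ->
  \sum_j \sum_(d < hbar.+1) mass s.+1 j d * z (N - s.+1 + hbar - d)%N j =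
  \sum_j \sum_(d < hbar.+1) mass s j d * z (N - s + hbar - d)%N j
  + \sum_i landed s i * defect z s i.
Proof.
move=> sN; rewrite (mass_step s (fun j d => z (N - s.+1 + hbar - d)%N j)).
under [X in _ = _ + X]eq_bigr do rewrite mulrBr.
rewrite [X in _ = _ + X]sumrB addrCA addrC; congr (_ + _).
rewrite -sumrB; apply: eq_bigr => j _.
rewrite big_ord_recl subn0 addrAC subrr add0r; apply: eq_bigr => d _.
by congr (_ * z _ _); rewrite /= /bump /=; clear -sN; lia.
Qed.

Lemma defect_total (z : nat -> V -> R) (c : R) :
  (forall m j, 0 <= z m j <= c) ->
  (forall s i, (s < N)%N -> 0 <= defect z s i) ->
  mass_floor * \sum_(0 <= s < N) \sum_i defect z s i <= #|V|%:R * c.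
Proof.
move=> z_bound def_ge0.
pose Q s := \sum_j \sum_(d < hbar.+1) mass s j d * z (N - s + hbar - d)%N j.
have telescoped n : (n <= N)%N ->
    Q n = Q 0%N + \sum_(0 <= s < n) \sum_i landed s i * defect z s i.
  elim: n => [|n IH] nN; first by rewrite big_geq// addr0.
  by rewrite big_nat_recr//= addrA -IH ?(ltnW nN)//; exact: pairing_step.
apply: (@le_trans _ _ (Q N)).
  rewrite telescoped// mulr_sumr -[leLHS]add0r lerD//.
    apply: sumr_ge0 => j _; apply: sumr_ge0 => d _.
    rewrite mulr_ge0 ?mass_ge0//.
    by case/andP: (z_bound (N - 0 + hbar - d)%N j).
  apply: ler_sum_nat => s /andP[_ sN]; rewrite mulr_sumr.
  apply: ler_sum => i _; rewrite ler_wpM2r ?def_ge0//.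
  by apply: landed_lower; exact: ltnW.
rewrite -(mass_total N) /mass_on big_mkcond mulr_suml.
apply: ler_sum => j _; rewrite inE /mass_at mulr_suml; apply: ler_sum => d _.
by rewrite ler_wpM2l ?mass_ge0//; case/andP: (z_bound (N - N + hbar - d)%N j).
Qed.

End Mass.

(** * Finite total dissipation and convergence *)

Lemma sum_nat_reverse (R : realType) (F : nat -> R) (N s1 s2 : nat) :
  (s1 <= s2 <= N)%N ->
  \sum_(s1 <= s < s2) F (N - s.+1)%N = \sum_(N - s2 <= t < N - s1) F t.
Proof.
elim: s2 => [|s2 IH]; first by move=> ?; rewrite !big_geq//; lia.
case/andP; rewrite leq_eqVlt => /orP[/eqP-> _|lt_s1 s2N].
  by rewrite !big_geq.
rewrite big_nat_recr//= IH; last by rewrite -ltnS lt_s1 ltnW.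
have lt : (N - s2.+1 < N - s1)%N by lia.
rewrite [RHS]big_ltn// addrC; congr (_ + _).
by congr bigop; congr index_iota; lia.
Qed.

Lemma weighted_variance (R : realType) (V : finType) (w f : V -> R) :
  \sum_j w j = 1 ->
  \sum_j w j * f j ^+ 2 - (\sum_j w j * f j) ^+ 2
    = \sum_j w j * (f j - \sum_k w k * f k) ^+ 2.
Proof.
move=> w1; pose m := \sum_k w k * f k; rewrite -/m.
have -> : \sum_j w j * (f j - m) ^+ 2 =
    \sum_j (w j * f j ^+ 2 + (- (2 * m)) * (w j * f j) + m ^+ 2 * w j).
  by apply: eq_bigr => j _; ring.
rewrite !big_split/= -!mulr_sumr w1 -/m; ring.
Qed.

Lemma summable_tail (R : realType) (u : nat -> R) (C e : R) :
  (forall m, 0 <= u m) -> (forall n, \sum_(0 <= m < n) u m <= C) -> 0 < e ->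
  exists m0, forall n, \sum_(m0 <= m < n) u m <= e.
Proof.
move=> u_ge0 u_le e_gt0; pose S := range (fun n => \sum_(0 <= m < n) u m).
have supS : has_sup S.
  by split; [exists (\sum_(0 <= m < 0) u m), 0%N|exists C => _ [n _ <-]].
have [_ [m0 _ <-] lt_sup] := sup_adherent e_gt0 supS.
exists m0 => n; have [nm|mn] := leqP n m0; first by rewrite big_geq// ltW.
have : \sum_(0 <= m < n) u m <= sup S.
  by apply: ub_le_sup; [case: supS|exists n].
rewrite (big_cat_nat (leq0n m0) (ltnW mn))/=; lra.
Qed.

(** Each value occupies at most one of the #|V| + 1 levels of height b above
    x. *)
Lemma empty_level (R : realType) (V : finType) (f : V -> R) (x b : R) :
  0 < b -> exists2 k, (k <= #|V|)%N &
    forall j, f j <= x + k%:R * b \/ x + k%:R * b + b <= f j.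
Proof.
move=> b_gt0; apply: contrapT => none.
have occupied (k : 'I_#|V|.+1) :
    exists j, (x + k%:R * b < f j) && (f j < x + k%:R * b + b).
  apply: contrapT => nj; apply: none; exists k; first by rewrite -ltnS.
  move=> j; have [?|lt1] := leP (f j) (x + k%:R * b); first by left.
  right; rewrite leNgt; apply/negP => lt2; apply: nj; exists j.
  by rewrite lt1 lt2.
pose h k := projT1 (cid (occupied k)).
have h_inj : injective h.
  have lt_h (k l : 'I_#|V|.+1) : (k < l)%N -> h k = h l -> False.
    rewrite /h; case: (cid _) => j /= /andP[_ j2].
    case: (cid _) => j' /= /andP[j1' _].
    move=> kl jj'; subst j'.
    have : (k.+1)%:R * b <= l%:R * b by rewrite ler_pM2r// ler_nat.
    rewrite -[k.+1]addn1 natrD; lra.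
  move=> k l hkl; apply/val_inj; case: (ltngtP k l) => // kl.
    by have := lt_h _ _ kl hkl.
  by have := lt_h _ _ kl (esym hkl).
by have := leq_card h h_inj; rewrite card_ord ltnn.
Qed.

Section Dynamics.
Variables (R : realType) (V : finType) (a : nat -> V -> V -> R).
Variables (g : nat -> V -> V -> nat) (hbar : nat).
Hypothesis a_stochastic : forall m, stochastic (a m).
Hypothesis g_le : forall m i j, (g m i j <= hbar)%N.

(** Index m stands for the time t0 + m - hbar, so that natural numbers also
    cover the initial data.  The weights of index m produce the value of index
    m + hbar + 1. *)
Definition delayed_averaging (X : nat -> V -> R) :=
  forall m i, X (m + hbar).+1 i = \sum_j a m i j * X (m + hbar - g m i j)%N j.

Definition dissipation (X : nat -> V -> R) m :=
  \sum_i \sum_j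
    a m i j * (X (m + hbar - g m i j)%N j - X (m + hbar).+1 i) ^+ 2.

Lemma a_ge0 m i j : 0 <= a m i j.
Proof. by case: (a_stochastic m). Qed.

#[local] Hint Resolve a_ge0 : core.

Lemma a_sum1 m i : \sum_j a m i j = 1.
Proof. by case: (a_stochastic m). Qed.

Lemma dissipation_ge0 X m : 0 <= dissipation X m.
Proof.
apply: sumr_ge0 => i _; apply: sumr_ge0 => j _.
by rewrite mulr_ge0 ?sqr_ge0 ?a_ge0.
Qed.

Lemma averaging_bounded X : delayed_averaging X ->
  exists2 b : R, 0 < b & forall m i, `|X m i| <= b.
Proof.
move=> avg; pose b := 1 + \sum_(k < hbar.+1) \sum_i `|X k i|.
have b_gt0 : 0 < b.
  by apply: ltr_pwDl => //; apply: sumr_ge0 => k _; apply: sumr_ge0.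
exists b => // m.
have [n] := ubnP m; elim: n m => // n IH m; rewrite ltnS => mn i.
have [mh|hm] := leqP m hbar.
  rewrite /b (bigD1 (Ordinal (mh : m < hbar.+1)%N))//= (bigD1 i)//=.
  apply: ler_wpDl => //; rewrite -addrA ler_wpDr// addr_ge0// sumr_ge0// => k _.
  exact: sumr_ge0.
have -> : m = (m - hbar.+1 + hbar).+1 by lia.
rewrite avg; apply: le_trans (ler_norm_sum _ _ _) _.
rewrite -[leRHS]mul1r -(a_sum1 (m - hbar.+1) i) mulr_suml.
apply: ler_sum => j _; rewrite normrM ger0_norm ?a_ge0// ler_wpM2l ?a_ge0//.
by apply: IH; lia.
Qed.

Definition opposite (X : nat -> V -> R) := fun m i => - X m i.

Lemma averaging_opposite X :
  delayed_averaging X -> delayed_averaging (opposite X).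
Proof.
move=> avg m i; rewrite /opposite avg -sumrN.
by apply: eq_bigr => j _; rewrite mulrN.
Qed.

Lemma dissipation_opposite X m : dissipation (opposite X) m = dissipation X m.
Proof.
apply: eq_bigr => i _; apply: eq_bigr => j _.
by rewrite /opposite -opprD sqrrN.
Qed.

Lemma dissipation_term X m i j :
  a m i j * (X (m + hbar - g m i j)%N j - X (m + hbar).+1 i) ^+ 2
    <= dissipation X m.
Proof.
have t_ge0 k l :
    0 <= a m k l * (X (m + hbar - g m k l)%N l - X (m + hbar).+1 k) ^+ 2.
  by rewrite mulr_ge0 ?sqr_ge0.
rewrite /dissipation (bigD1 i)//= (bigD1 j)//= -addrA lerDl.
by rewrite addr_ge0 ?sumr_ge0// => k _; rewrite sumr_ge0.
Qed.

(** An agent that is led across the gap by a weight w gains at most 2 M w, while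
    the dissipation is at least w (b / 4)^2; this is the ratio of the two. *)
Definition crossing_cost (M b : R) := 32 * M / b ^+ 2.

Lemma crossing_cost_gt0 M b : 0 < M -> 0 < b -> 0 < crossing_cost M b.
Proof. by move=> *; rewrite divr_gt0 ?mulr_gt0 ?exprn_gt0. Qed.

(** The values of S exceed c + e only through weights that lead across the gap,
    which has width at least b / 4 even after the step; these are paid for by
    the dissipation. *)
Lemma separated_step X (S : {set V}) M b c e m i :
  delayed_averaging X -> (forall m i, `|X m i| <= M) -> 0 < b -> e <= b / 3 ->
  (forall d j, (d <= hbar)%N ->
     if j \in S then X (m + hbar - d)%N j <= c + e
     else c + b - e <= X (m + hbar - d)%N j) ->
  `|X (m + hbar).+1 i - X (m + hbar)%N i| <= b / 12 ->
  i \in S ->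
  X (m + hbar).+1 i <= c + e + crossing_cost M b * dissipation X m.
Proof.
move=> avg XM b_gt0 eb window inc iS.
have now : X (m + hbar)%N i <= c + e.
  by have := window 0%N i (leq0n _); rewrite iS subn0.
have next : X (m + hbar).+1 i <= c + e + b / 12.
  by move: inc; rewrite ler_norml => /andP[_]; lra.
have M_ge0 : 0 <= M by apply: le_trans (XM 0%N i).
have cost_ge0 : 0 <= crossing_cost M b.
  by rewrite divr_ge0 ?mulr_ge0 ?exprn_ge0// ltW.
have -> : X (m + hbar).+1 i = c + e
    + \sum_j a m i j * (X (m + hbar - g m i j)%N j - (c + e)).
  under eq_bigr do rewrite mulrBr.
  by rewrite sumrB -mulr_suml a_sum1 mul1r avg addrC subrK.
rewrite lerD2l; apply: (@le_trans _ _ (crossing_cost M b * \sum_j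
    a m i j * (X (m + hbar - g m i j)%N j - X (m + hbar).+1 i) ^+ 2)).
  rewrite mulr_sumr; apply: ler_sum => j _.
  rewrite mulrCA ler_wpM2l//; have := window _ j (g_le m i j).
  set y := X _ j; case: ifP => jS yS.
    by apply: (@le_trans _ _ 0); [lra|rewrite mulr_ge0 ?sqr_ge0].
  have gap : b / 4 <= y - X (m + hbar).+1 i by lra.
  have sq : b ^+ 2 / 16 <= (y - X (m + hbar).+1 i) ^+ 2.
    have -> : b ^+ 2 / 16 = (b / 4) ^+ 2 by field.
    by rewrite ler_pXn2r ?nnegrE//; lra.
  apply: (@le_trans _ _ (crossing_cost M b * (b ^+ 2 / 16))); last first.
    by rewrite ler_wpM2l.
  have -> : crossing_cost M b * (b ^+ 2 / 16) = 2 * M.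
    by rewrite /crossing_cost; field; rewrite gt_eqF.
  have := XM (m + hbar - g m i j)%N j; have := XM (m + hbar)%N i.
  rewrite -/y !ler_norml => /andP[? _] /andP[_ ?]; lra.
rewrite ler_wpM2l// /dissipation [leRHS](bigD1 i)//= lerDl.
by apply: sumr_ge0 => k _; apply: sumr_ge0 => l _; rewrite mulr_ge0 ?sqr_ge0.
Qed.

Variable eta : R.
Hypothesis eta_gt0 : 0 < eta.
Hypothesis a_diag : forall m i, eta <= a m i i.
Hypothesis g_diag : forall m i, g m i i = 0%N.

(** The remaining dissipation is too small to close more than b / 4 of a gap,
    and the values vary by at most b / 12 over a window of [hbar] steps. *)
Definition settled X M b m0 :=
  (forall n,
     \sum_(m0 <= m < n) dissipation X m <= (b / 4) / crossing_cost M b) /\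
  (forall m i, (m0 <= m)%N ->
     `|X (m + hbar).+1 i - X (m + hbar)%N i| <= b / 12 / hbar.+1%:R).

Lemma settled_opposite X M b m0 :
  settled X M b m0 -> settled (opposite X) M b m0.
Proof.
move=> [tail inc]; split=> [n|m i m0m].
  by under eq_bigr do rewrite dissipation_opposite.
by rewrite /opposite -opprD normrN; exact: inc.
Qed.

Lemma eventually_settled X M b C : 0 < M -> 0 < b ->
  delayed_averaging X -> (forall n, \sum_(0 <= m < n) dissipation X m <= C) ->
  exists m0, settled X M b m0.
Proof.
move=> M_gt0 b_gt0 avg dissC.
pose d := b / 12 / hbar.+1%:R.
have d_gt0 : 0 < d by rewrite !divr_gt0.
pose e := Order.min ((b / 4) / crossing_cost M b) (eta * d ^+ 2).
have e_gt0 : 0 < e.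
  by rewrite lt_min !divr_gt0 ?crossing_cost_gt0// mulr_gt0 ?exprn_gt0.
have diss_ge0 m : 0 <= dissipation X m by exact: dissipation_ge0.
have [m0 tail] := summable_tail diss_ge0 dissC e_gt0.
exists m0; split => [n|m i m0m].
  by apply: le_trans (tail n) _; rewrite /e ge_min lexx.
have : eta * (X (m + hbar)%N i - X (m + hbar).+1 i) ^+ 2 <= eta * d ^+ 2.
  apply: (@le_trans _ _ e); last by rewrite /e ge_min lexx orbT.
  apply: le_trans (tail m.+1); rewrite big_nat_recr//=.
  apply: (@le_trans _ _ (dissipation X m)); last by rewrite lerDr sumr_ge0.
  apply: le_trans (dissipation_term X m i i); rewrite g_diag subn0.
  by rewrite ler_wpM2r ?sqr_ge0.
rewrite ler_pM2l// distrC -[(_ - _) ^+ 2]real_normK ?num_real//.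
by rewrite ler_pXn2r ?nnegrE// ltW.
Qed.

Lemma settled_increment X M b m0 d i : settled X M b m0 -> (d <= hbar)%N ->
  0 < b -> `|X (m0 + hbar + hbar - d)%N i - X (m0 + hbar + hbar)%N i| <= b / 12.
Proof.
move=> [_ inc] dh b_gt0.
apply: (@le_trans _ _ (d%:R * (b / 12 / hbar.+1%:R))).
  elim: d dh => [|d IH] dh; first by rewrite subn0 subrr normr0 mul0r.
  apply: le_trans (ler_distD (X (m0 + hbar + hbar - d)%N i) _ _) _.
  rewrite -[d.+1]add1n natrD mulrDl mul1r lerD ?IH ?(ltnW dh)//.
  have hd : (m0 + hbar + hbar - d = (m0 + hbar - d.+1 + hbar).+1)%N by lia.
  have hd' : (m0 + hbar + hbar - d.+1 = (m0 + hbar - d.+1 + hbar))%N by lia.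
  by rewrite hd hd' distrC; apply: inc; lia.
rewrite mulrA ler_pdivrMr ?ltr0n// mulrC ler_wpM2l//; first by lra.
by rewrite ler_nat ltnW.
Qed.

(** At the time of index m0 + hbar + hbar the whole delay window is already in
    the quiet regime.  The slack e starts at b / 12, the variation inside that
    window, and grows with the dissipation, staying below b / 3; as long as it
    does, the step estimate applies to S and, after a change of sign, to its
    complement. *)
Lemma stay_separated X (S : {set V}) M b c m0 :
  delayed_averaging X -> (forall m i, `|X m i| <= M) -> 0 < M -> 0 < b ->
  settled X M b m0 ->
  (forall j, if j \in S then X (m0 + hbar + hbar)%N j <= c
     else c + b <= X (m0 + hbar + hbar)%N j) ->
  forall n i, (m0 + hbar <= n)%N -> i \in S -> X (n + hbar)%N i <= c + b / 3.
Proof.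
move=> avg XM M_gt0 b_gt0 settl sep.
pose e n :=
  b / 12 + crossing_cost M b * \sum_(m0 + hbar <= m < n) dissipation X m.
have r_gt0 := crossing_cost_gt0 M_gt0 b_gt0.
have diss_ge0 m : 0 <= dissipation X m by exact: dissipation_ge0.
have e_le n : e n <= b / 3.
  have : crossing_cost M b * \sum_(m0 + hbar <= m < n) dissipation X m <= b / 4.
    rewrite mulrC -ler_pdivlMr//; case: settl => tail _.
    have [nh|hn] := leqP n (m0 + hbar).
      rewrite big_geq//; apply: divr_ge0; last exact: ltW.
      by apply: divr_ge0 => //; exact: ltW.
    apply: le_trans (tail n).
    rewrite (big_cat_nat (leq_addr hbar m0) (ltnW hn))/=.
    by rewrite lerDr sumr_ge0.
  by rewrite /e; lra.
have inc n i : (m0 + hbar <= n)%N ->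
    `|X (n + hbar).+1 i - X (n + hbar)%N i| <= b / 12.
  move=> hn; case: settl => _ /(_ n i) H.
  apply: le_trans (H _) _; first by apply: leq_trans hn; exact: leq_addr.
  by rewrite ler_pdivrMr ?ltr0n// ler_peMr ?ler1n//; lra.
have window k d j : (d <= hbar)%N ->
    if j \in S then X (m0 + hbar + k + hbar - d)%N j <= c + e (m0 + hbar + k)%N
    else c + b - e (m0 + hbar + k)%N <= X (m0 + hbar + k + hbar - d)%N j.
  elim: k d j => [|k IH] d j dh.
    rewrite addn0 /e big_geq// mulr0 addr0.
    have := settled_increment j settl dh b_gt0; rewrite ler_norml => /andP[].
    by have := sep j; case: ifP => _; lra.
  move: IH; rewrite addnS; set n := (m0 + hbar + k)%N => IH.
  have hn : (m0 + hbar <= n)%N by exact: leq_addr.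
  have e_step : e n.+1 = e n + crossing_cost M b * dissipation X n.
    by rewrite /e big_nat_recr//= mulrDr addrA.
  have rd_ge0 : 0 <= crossing_cost M b * dissipation X n.
    by rewrite mulr_ge0// ltW.
  case: d dh => [|d] dh; last first.
    rewrite addSn subSS; have := IH d j (ltnW dh).
    by case: ifP => _; rewrite e_step; lra.
  rewrite subn0 addSn e_step; case: ifP => jS.
    by rewrite addrA; apply: separated_step IH (inc _ _ hn) jS.
  have := @separated_step (opposite X) (~: S) M b (- (c + b)) (e n) n j.
  rewrite dissipation_opposite inE jS /opposite => H.
  have : - X (n + hbar).+1 j
      <= - (c + b) + e n + crossing_cost M b * dissipation X n.
    apply: H => //.
    - exact: averaging_opposite.
    - by move=> m k'; rewrite normrN.
    - move=> d' k' d'h; have := IH d' k' d'h; rewrite inE.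
      by case: (k' \in S) => /=; lra.
    - by rewrite -opprD normrN; exact: inc.
  lra.
move=> n i hn iS; have := window (n - (m0 + hbar))%N 0%N i (leq0n _).
by rewrite iS subn0 subnKC// => h; apply: le_trans h _; rewrite lerD2l.
Qed.

(** An empty level just above the value of the agent acts as a barrier for
    it. *)
Lemma stay_below X M b m0 :
  delayed_averaging X -> (forall m i, `|X m i| <= M) ->
  0 < M -> 0 < b -> settled X M b m0 ->
  forall m i, (m0 + hbar + hbar <= m)%N ->
  X m i <= X (m0 + hbar + hbar)%N i + #|V|.+1%:R * b.
Proof.
move=> avg XM M_gt0 b_gt0 settl m i hm; set p := (m0 + hbar + hbar)%N in hm *.
have [k kV sep] := empty_level (X p) (X p i) b_gt0.
pose S := [set j | X p j <= X p i + k%:R * b]%SET.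
have iS : i \in S by rewrite inE lerDl mulr_ge0// ltW.
have sepS j : if j \in S then X p j <= X p i + k%:R * b
    else X p i + k%:R * b + b <= X p j.
  by rewrite inE; case: ifPn => // /negP hj; case: (sep j).
have hn : (m0 + hbar <= m - hbar)%N.
  by rewrite leq_subRL ?(leq_trans _ hm) ?leq_addl// addnC.
have := stay_separated avg XM M_gt0 b_gt0 settl sepS hn iS.
rewrite subnK; last by rewrite (leq_trans _ hm)// leq_addl.
move/le_trans; apply.
have : k%:R * b <= #|V|%:R * b by rewrite ler_pM2r// ler_nat.
rewrite -[#|V|.+1]addn1 natrD; lra.
Qed.

Lemma averaging_cvg X C : delayed_averaging X ->
  (forall n, \sum_(0 <= m < n) dissipation X m <= C) ->
  forall i, cvgn (fun m => X m i).
Proof.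
move=> avg dissC i; have [M M_gt0 XM] := averaging_bounded avg.
apply/cauchy_cvgP/cauchy_exP => eps eps_gt0.
pose b := eps / 2 / #|V|.+1%:R.
have b_gt0 : 0 < b by rewrite !divr_gt0.
have [m0 settl] := eventually_settled M_gt0 b_gt0 avg dissC.
exists (X (m0 + hbar + hbar)%N i); exists (m0 + hbar + hbar)%N => //= m hm.
have up := stay_below avg XM M_gt0 b_gt0 settl i hm.
have XM' m' k : `|opposite X m' k| <= M by rewrite normrN.
have low := stay_below (averaging_opposite avg) XM' M_gt0 b_gt0
  (settled_opposite settl) i hm.
have bE : #|V|.+1%:R * b = eps / 2 by rewrite /b mulrC divfK.
rewrite bE in up low; rewrite /opposite in low.
rewrite /ball/= ltr_norml; apply/andP; split; lra.
Qed.

(** Once the values are close to their limits, the weight of the arc is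
    proportional to a part of the dissipation. *)
Lemma separated_limits_finite_weight X C i j : delayed_averaging X ->
  (forall n, \sum_(0 <= m < n) dissipation X m <= C) ->
  limn (fun m => X m i) != limn (fun m => X m j) ->
  exists W : R, forall n, \sum_(0 <= m < n) a m i j <= W.
Proof.
move=> avg dissC; set l := limn _; set l' := limn _ => ll'.
pose d := `|l - l'| / 4.
have d_gt0 : 0 < d by rewrite divr_gt0// normr_gt0 subr_eq0.
have close k : exists p, forall m, (p <= m)%N ->
    `|limn (fun m => X m k) - X m k| < d.
  have /cvgrPdist_lt/(_ d d_gt0)[p _ hp] := averaging_cvg avg dissC (i := k).
  by exists p => m /hp.
have [p hp] := close i; have [p' hp'] := close j.
pose q := (p + p')%N.
have far m : (q <= m)%N -> a m i j <= (d ^+ 2)^-1 * dissipation X m.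
  move=> qm; rewrite ler_pdivlMl ?exprn_gt0//.
  apply: le_trans (dissipation_term X m i j); rewrite mulrC ler_wpM2l//.
  rewrite -[leRHS]real_normK ?num_real// ler_pXn2r ?nnegrE// ?(ltW d_gt0)//.
  have h1 := hp (m + hbar).+1; have h2 := hp' (m + hbar - g m i j)%N.
  have {}h1 := h1 ltac:(rewrite /q in qm; lia).
  have {}h2 := h2 ltac:(have := g_le m i j; rewrite /q in qm; lia).
  rewrite -/l in h1; rewrite -/l' in h2.
  have := ler_distD (X (m + hbar).+1 i) l l'.
  have := ler_distD (X (m + hbar - g m i j)%N j) (X (m + hbar).+1 i) l'.
  rewrite [`|X (m + hbar).+1 i - X (m + hbar - _)%N j|]distrC.
  rewrite [`|X (m + hbar - _)%N j - l'|]distrC.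
  have : `|l - l'| = d * 4 by rewrite /d divfK.
  lra.
have C_ge0 : 0 <= C by have := dissC 0%N; rewrite big_geq.
exists (\sum_(0 <= m < q) a m i j + (d ^+ 2)^-1 * C) => n.
have far_ge0 : 0 <= (d ^+ 2)^-1 by rewrite invr_ge0 exprn_ge0// ltW.
have [nq|qn] := leqP n q.
  rewrite ler_wpDr ?mulr_ge0//; rewrite (big_cat_nat (leq0n n) nq)/= lerDl.
  by rewrite sumr_ge0.
rewrite (big_cat_nat (leq0n q) (ltnW qn))/= lerD2l.
apply: (@le_trans _ _ ((d ^+ 2)^-1 * \sum_(q <= m < n) dissipation X m)).
  by rewrite mulr_sumr; apply: ler_sum_nat => m /andP[/far].
rewrite ler_wpM2l//; apply: le_trans (dissC n).
rewrite (big_cat_nat (leq0n q) (ltnW qn))/= lerDr.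
by apply: sumr_ge0 => m _; exact: dissipation_ge0.
Qed.

Variables K E : R.
Hypothesis K_ge1 : 1 <= K.
Hypothesis E_ge0 : 0 <= E.
Hypothesis a_reciprocal : forall i j m1 m2, i != j -> (m1 <= m2)%N ->
  \sum_(m1 <= m < m2) a m i j <= K * \sum_(m1 <= m < m2) a m j i + E.

(** The backward transport with horizon N reads the weights in reverse order;
    reciprocity over arbitrary intervals survives this reversal, whereas blocks
    starting at prescribed times would not fit an arbitrary horizon. *)
Lemma dissipation_summable X : delayed_averaging X ->
  exists C : R, forall N, \sum_(0 <= m < N) dissipation X m <= C.
Proof.
move=> avg; have [b b_gt0 Xb] := averaging_bounded avg.
exists ((mass_floor V hbar eta K E)^-1 * (#|V|%:R * b ^+ 2)) => N.
pose B s := a (N - s.+1); pose H s := g (N - s.+1).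
rewrite ler_pdivlMl ?mass_floor_gt0//.
have B_reciprocal i j s1 s2 : i != j -> (s1 <= s2 <= N)%N ->
    \sum_(s1 <= s < s2) B s i j <= K * \sum_(s1 <= s < s2) B s j i + E.
  move=> ij hs; rewrite !(sum_nat_reverse (fun t => a t _ _))//.
  by apply: a_reciprocal => //; lia.
pose z m i := X m i ^+ 2.
have defectE s i : (s < N)%N -> defect B H hbar N z s i =
    \sum_j B s i j *
      (X (N - s.+1 + hbar - H s i j)%N j - X (N - s.+1 + hbar).+1 i) ^+ 2.
  move=> sN; rewrite avg -weighted_variance ?a_sum1// -avg /defect.
  by rewrite /z; congr (_ - X _ _ ^+ 2); lia.
have -> : \sum_(0 <= m < N) dissipation X m =
    \sum_(0 <= s < N) \sum_i defect B H hbar N z s i.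
  have := sum_nat_reverse (dissipation X) (_ : (0 <= N <= N)%N).
  rewrite subnn subn0 leqnn => <-//.
  apply: eq_big_nat => s /andP[_ sN]; apply: eq_bigr => i _.
  by rewrite defectE.
apply: defect_total => //.
- by move=> s; exact: a_stochastic.
- by move=> s i; exact: a_diag.
- by move=> s i j; exact: g_le.
- by move=> s i; exact: g_diag.
- move=> m j; rewrite sqr_ge0/= -[leLHS]real_normK ?num_real//.
  by rewrite ler_pXn2r ?nnegrE// ltW.
- move=> s i sN; rewrite defectE//; apply: sumr_ge0 => j _.
  by rewrite mulr_ge0 ?sqr_ge0// a_ge0.
Qed.

End Dynamics.

(** * Reciprocity over arbitrary intervals *)

Lemma weight_le1 (R : realType) (V : finType) (w : V -> V -> R) i j :
  stochastic w -> w i j <= 1.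
Proof.
move=> [w_ge0 w_sum]; rewrite -(w_sum i) (bigD1 j)//= lerDl.
by apply: sumr_ge0.
Qed.

Lemma sum_le_length (R : realType) (f : nat -> R) s t :
  (forall r, f r <= 1) -> \sum_(s <= r < t) f r <= t%:R.
Proof.
move=> f_le1; apply: (@le_trans _ _ (\sum_(s <= r < t) 1)).
  exact: ler_sum.
by rewrite sumr_const_nat ler_nat leq_subr.
Qed.

Lemma sum_widen (R : realType) (f : nat -> R) s' s t t' :
  (forall r, 0 <= f r) -> (s' <= s)%N -> (t <= t')%N ->
  \sum_(s <= r < t) f r <= \sum_(s' <= r < t') f r.
Proof.
move=> f_ge0 s's tt'; have [ts|st] := leqP t s.
  by rewrite big_geq ?sumr_ge0.
rewrite (big_cat_nat s's (leq_trans (ltnW st) tt'))/=.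
rewrite (big_cat_nat (ltnW st) tt')/= addrCA lerDl.
by rewrite addr_ge0 ?sumr_ge0.
Qed.

(** An interval consists of full blocks, for which the comparison holds, and of
    two incomplete blocks of weight at most M each; if it begins before the
    first block, the initial part has weight at most T 0. *)
Lemma blocks_reciprocal (R : realType) (f f' : nat -> R) (T : nat -> nat)
    (K M : R) :
  (forall r, 0 <= f r <= 1) -> (forall r, 0 <= f' r) ->
  (forall p, (T p < T p.+1)%N) -> 0 <= K -> 0 <= M ->
  (forall p, \sum_(T p <= r < T p.+1) f r
     <= K * \sum_(T p <= r < T p.+1) f' r) ->
  (forall p, \sum_(T p <= r < T p.+1) f r <= M) ->
  forall s t, (s <= t)%N ->
    \sum_(s <= r < t) f r <= K * \sum_(s <= r < t) f' r + ((T 0%N)%:R + 2 * M).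
Proof.
move=> f01 f'_ge0 T_lt K_ge0 M_ge0 fK fM s t st.
have f_ge0 r : 0 <= f r by case/andP: (f01 r).
have T_le p q : (p <= q)%N -> (T p <= T q)%N.
  by apply: (homo_leq (leqnn) (leq_trans)) => k; exact: ltnW.
have T_ge p : (p <= T p)%N.
  by elim: p => // p IH; exact: leq_ltn_trans IH (T_lt p).
have T0_ge0 : 0 <= (T 0%N)%:R :> R by [].
have blocks p q : (p <= q)%N ->
    \sum_(T p <= r < T q) f r <= K * \sum_(T p <= r < T q) f' r.
  elim: q => [|q IH].
    by rewrite leqn0 => /eqP ->; rewrite !big_geq// mulr0.
  rewrite leq_eqVlt ltnS => /orP[/eqP->|pq]; first by rewrite !big_geq// mulr0.
  have qq := ltnW (T_lt q).
  rewrite (big_cat_nat (T_le _ _ pq) qq)/=.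
  rewrite [X in K * X](big_cat_nat (T_le _ _ pq) qq)/=.
  by rewrite mulrDr lerD ?IH.
have rest_ge0 s' t' : 0 <= K * \sum_(s' <= r < t') f' r.
  by rewrite mulr_ge0 ?sumr_ge0.
have within p s' t' : (T p <= s')%N -> (t' <= T p.+1)%N ->
    \sum_(s' <= r < t') f r <= M.
  by move=> *; apply: le_trans (fM p); exact: sum_widen.
have [p sp left_part] : exists2 p, (s <= T p)%N &
    \sum_(s <= r < T p) f r <= (T 0%N)%:R + M.
  have ex_p : exists p, (s <= T p)%N by exists s.
  case: (ex_minnP ex_p) => -[|p] sp pmin.
    exists 0%N => //; rewrite ler_wpDr// sum_le_length// => r.
    by case/andP: (f01 r).
  exists p.+1 => //; rewrite ler_wpDl//; apply: (within p) => //.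
  by rewrite leqNgt; apply/negP => /ltnW /pmin; rewrite ltnn.
have [tp|pt] := leqP t (T p).
  have : \sum_(s <= r < t) f r <= \sum_(s <= r < T p) f r by exact: sum_widen.
  by have := rest_ge0 s t; lra.
have [q [pq qt tq]] : exists q, [/\ (p <= q)%N, (T q <= t)%N & (t < T q.+1)%N].
  have ex_k : exists k, (t < T k)%N by exists t.+1; exact: T_ge.
  case: (ex_minnP ex_k) => -[|q] tq qmin.
    by have := T_le _ _ (leq0n p); rewrite leqNgt (ltn_trans pt tq).
  exists q; split => //.
    rewrite leqNgt; apply/negP => /T_le; rewrite leqNgt.
    by rewrite (ltn_trans pt tq).
  by rewrite leqNgt; apply/negP => /qmin; rewrite ltnn.
have right_part := within q (T q) t (leqnn _) (ltnW tq).
have middle := blocks p q pq.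
have widen : K * \sum_(T p <= r < T q) f' r <= K * \sum_(s <= r < t) f' r.
  by rewrite ler_wpM2l// sum_widen.
rewrite (big_cat_nat sp (ltnW pt))/= (big_cat_nat (T_le _ _ pq) qt)/=.
lra.
Qed.

Lemma NITS_reciprocal (R : realType) (V : finType) (A : nat -> V -> V -> R) :
  (forall t, stochastic (A t)) -> NITS A ->
  exists K E : R, [/\ 1 <= K, 0 <= E &
    forall i j s t, i != j -> (s <= t)%N ->
      \sum_(s <= r < t) A r i j <= K * \sum_(s <= r < t) A r j i + E].
Proof.
move=> A_st [T [K [T_lt K_ge1 AK [M AM]]]].
have M_ge0 : 0 <= Order.max M 0 by rewrite le_max lexx orbT.
exists K, ((T 0%N)%:R + 2 * Order.max M 0); split => //.
  by rewrite addr_ge0// mulr_ge0.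
move=> i j s t ij st.
apply: (@blocks_reciprocal _ (fun r => A r i j) (fun r => A r j i)) => //.
- by move=> r; rewrite weight_le1// andbT; case: (A_st r).
- by move=> r; case: (A_st r).
- exact: le_trans K_ge1.
- by move=> p; case/andP: (AK i j p).
- by move=> p; rewrite le_max AM.
Qed.

(** * Solutions of the delayed algorithm *)

Section Solutions.
Variables (R : realType) (V : finType) (A : nat -> V -> V -> R).
Variables (hbar : nat) (h : nat -> V -> V -> nat).
Hypothesis A_stochastic : forall t, stochastic (A t).
Hypothesis h_bounded : forall t i j, (h t i j <= hbar)%N.
Hypothesis A_NITS : NITS A.
Hypothesis A_aperiodic : strongly_aperiodic A.
Variables (t0 : nat) (x : int -> V -> R).
Hypothesis x_solution : solution A h t0 x.

Let a m := A (t0 + m)%N.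
Let g m i j := if i == j then 0%N else h (t0 + m)%N i j.
Let X (m : nat) (i : V) := x ((t0 + m)%N%:Z - hbar%:Z) i.

(** The own weight is the complement of the other weights, so the increment form
    of the algorithm is a mean in which the own value has delay 0. *)
Lemma shifted_averaging : delayed_averaging a g hbar X.
Proof.
move=> m i; rewrite /X.
have -> : (t0 + (m + hbar).+1)%N%:Z - hbar%:Z = (t0 + m).+1%:Z by lia.
rewrite x_solution ?leq_addr//.
have [_ /(_ i) sum1] := A_stochastic (t0 + m).
have others : \sum_(j | j != i) A (t0 + m)%N i j = 1 - a m i i.
  by rewrite -sum1 [X in _ = X - _](bigD1 i)//= addrAC subrr add0r.
under eq_bigr do rewrite mulrBr.
rewrite sumrB -mulr_suml others [RHS](bigD1 i)//=.
have -> : (t0 + (m + hbar - g m i i))%N%:Z - hbar%:Z = (t0 + m)%N%:Z :> int.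
  by rewrite /g eqxx; lia.
rewrite (_ : forall u v w : R, u + (v - (1 - w) * u) = w * u + v); last first.
  by move=> *; ring.
congr (_ + _).
apply: eq_bigr => j ji; congr (_ * x _ _).
have -> : g m i j = h (t0 + m) i j by rewrite /g eq_sym (negbTE ji).
by have := h_bounded (t0 + m) i j; lia.
Qed.

Lemma shifted_dissipation : exists C : R,
  forall N, \sum_(0 <= m < N) dissipation a g hbar X m <= C.
Proof.
have [eta eta_gt0 A_diag] := A_aperiodic.
have [K [E [K_ge1 E_ge0 recip]]] := NITS_reciprocal A_stochastic A_NITS.
apply: (@dissipation_summable _ _ a g hbar _ _ eta _ _ _ K E) => //.
- by move=> m; exact: A_stochastic.
- by move=> m i j; rewrite /g; case: eqP.
- by move=> m i; exact: A_diag.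
- by move=> m i; rewrite /g eqxx.
- move=> i j m1 m2 ij m12.
  have shift k l : \sum_(m1 <= m < m2) a m k l =
      \sum_(m1 + t0 <= t < m2 + t0) A t k l.
    by rewrite big_addn addnK; apply: eq_bigr => m _; rewrite addnC.
  by rewrite !shift; apply: recip; rewrite // leq_add2r.
- exact: shifted_averaging.
Qed.

Let a_stochastic m : stochastic (a m).
Proof. exact: A_stochastic. Qed.

Let g_le m i j : (g m i j <= hbar)%N.
Proof. by rewrite /g; case: eqP. Qed.

Let g_diag m i : g m i i = 0%N.
Proof. by rewrite /g eqxx. Qed.

Lemma trajectory_cvg_shifted i :
  trajectory x i @ \oo --> limn (fun m => X m i).
Proof.
have [eta eta_gt0 A_diag] := A_aperiodic.
have [C XC] := shifted_dissipation.
have cvgX : cvgn (fun m => X m i).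
  exact: (averaging_cvg a_stochastic g_le eta_gt0 (fun m => A_diag (t0 + m)%N)
    g_diag shifted_averaging XC).
rewrite -(cvg_shiftn t0).
rewrite (_ : [sequence trajectory x i (n + t0)%N]_n =
             [sequence X (n + hbar)%N i]_n).
  by rewrite (cvg_shiftn hbar (fun m => X m i)).
by apply/funext => n; rewrite /X /trajectory; congr (x _ _); lia.
Qed.

Lemma persistent_arc_same_limit i j : persistent_graph A j i ->
  limn (trajectory x i) = limn (trajectory x j).
Proof.
move=> /andP[_ /asboolP infinite].
rewrite (cvg_lim _ (@trajectory_cvg_shifted i))//.
rewrite (cvg_lim _ (@trajectory_cvg_shifted j))//.
apply/eqP; apply: contraT => ne.
have [eta eta_gt0 A_diag] := A_aperiodic.
have [C XC] := shifted_dissipation.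
have [W W_le] := separated_limits_finite_weight a_stochastic g_le eta_gt0
  (fun m => A_diag (t0 + m)%N) g_diag shifted_averaging XC ne.
have A_ge0 t : 0 <= A t i j by case: (A_stochastic t).
have partial n : \sum_(0 <= t < n) A t i j <= t0%:R + W.
  apply: (@le_trans _ _ (\sum_(0 <= t < n + t0) A t i j)).
    by apply: sum_widen; rewrite // leq_addr.
  rewrite (big_cat_nat (leq0n t0) (leq_addl n t0))/= lerD//.
    by apply: sum_le_length => t; exact: weight_le1.
  rewrite -{1}[t0]add0n big_addn addnK; apply: le_trans (W_le n).
  by apply: ler_sum => m _; rewrite addnC.
suff : (\sum_(0 <= t <oo) (A t i j)%:E <= (t0%:R + W)%:E)%E by rewrite infinite.
apply: lime_le; first by apply: is_cvg_nneseries => t _ _; rewrite lee_fin.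
by apply: nearW => n; rewrite sumEFin lee_fin.
Qed.

Lemma component_same_limit i j : same_component (persistent_graph A) i j ->
  limn (trajectory x i) = limn (trajectory x j).
Proof.
move=> /connectP[p]; elim: p i => [|k p IH] i /=; first by move=> _ ->.
by move=> /andP[/persistent_arc_same_limit <- /IH]; exact.
Qed.

End Solutions.

Unset Implicit Arguments.
Set Strict Implicit.

Theorem theorem4 (R : realType) (V : finType) (V_nonempty : (0 < #|V|)%N)
    (A : nat -> V -> V -> R) (hbar : nat) (h : nat -> V -> V -> nat)
    (A_stochastic : forall t, stochastic (A t))
    (h_bounded : forall t i j, (h t i j <= hbar)%N)
    (A_NITS : NITS A)
    (A_aperiodic : strongly_aperiodic A) :
  (forall (t0 : nat) (x : int -> V -> R), solution A h t0 x ->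
     forall i, cvgn (trajectory x i)) /\
  (forall i j, same_component (persistent_graph A) i j ->
     establishes_consensus A h i j).
Proof.
have converge t0 x : solution A h t0 x -> forall i, cvgn (trajectory x i).
  move=> sol i; apply: cvgP.
  exact: (trajectory_cvg_shifted A_stochastic h_bounded A_NITS A_aperiodic sol).
split => // i j ij t0 x sol.
split; [exact: converge sol _|exact: converge sol _|].
exact: (component_same_limit A_stochastic h_bounded A_NITS A_aperiodic sol).
Qed.
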